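(* Let $d_n>0$ be any sequence with $d_n\to 0$. Then there exists an infinitely renormalizable $C^2$ unimodal map $f$ with quadratic tip such that, for every $n$, $$\mathrm{dist}_0\left(R^nf,\ f^{\omega}_*\right)\ \ge\ d_n.$$
   Context: A unimodal map $f:[0,1]\to[0,1]$ is a $C^1$ map with $f(1)=0$, with a unique point $c\in(0,1)$ (the critical point) where $Df(c)=0$, and with $f(c)=1$. It is a $C^r$ unimodal map if $f$ is $C^r$. The critical point $c$ is a quadratic tip if there exist a sequence of points $x_n\to c$ and a constant $A>0$ such that $\lim_{n\to\infty}\frac{f(x_n)-f(c)}{(x_n-c)^2}=-A$. The set of $C^r$ unimodal maps with a quadratic tip is denoted $\mathcal U^r$. A unimodal map $f$ with quadratic tip $c$ is renormalizable if (1) $c\in[f^2(c),f^4(c)]=:I_0^1$, (2) $f(I_0^1)=[f^3(c),f(c)]=:I_1^1$, (3) $I_0^1\cap I_1^1=\emptyset$. The (period doubling) renormalization of $f$ is $Rf=h^{-1}\circ f^2\circ h$, where $h:[0,1]\to I_0^1$ is the orientation reversing affine homeomorphism; $Rf$ is again a unimodal map. The map $f$ is infinitely renormalizable if $R^nf$ is defined and renormalizable for all $n\ge 0$. $\mathrm{dist}_0$ is the $C^0$ distance. $f_*^\omega$ denotes the analytic renormalization fixed point: by a theorem of Davie, for $\alpha<1$ close enough to $1$ there is a unique renormalization fixed point $f_*^\omega\in\mathcal U^{2+\alpha}$ (i.e. $Rf_*^\omega=f_*^\omega$), and it is analytic; here $\mathcal U^{2+\alpha}$ consists of the unimodal maps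 with quadratic tip whose second derivative is $\alpha$-Hölder.
   Formalization: Since dist_0 ≤ 1, the claim fails if e.g. d_0 = 2; the bound d_n is replaced by min(d_n, ε) for every n, where ε > 0 depends only on f_*^ω and not on the sequence, so the original bound holds for all large n, and for all n if every d_n ≤ ε. *)

(* Defs.v *)
From Stdlib Require Import Reals Lra ClassicalEpsilon.
From Coquelicot Require Import Coquelicot.
Open Scope R_scope.

(* A map of [0,1] is a function R -> R of which only the values on [0,1] are
   ever constrained or used; continuity and derivatives are relative to [0,1]
   (one-sided at the end points). *)
Definition I01 (x : R) : Prop := 0 <= x <= 1.

Fixpoint Cr (r : nat) (f : R -> R) : Prop :=
  match r with
  | O => forall x, I01 x -> continue_in f I01 x
  | S r' => exists df, (forall x, I01 x -> D_in f df I01 x) /\ Cr r' df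
  end.

Definition is_critical (f : R -> R) (c : R) : Prop :=
  0 < c < 1 /\ D_in f (fun _ => 0) I01 c.

(* Meaningful when there is exactly one such point, as [unimodal] demands. *)
Definition critical_point (f : R -> R) : R :=
  epsilon (inhabits 0) (is_critical f).

Definition unimodal (f : R -> R) : Prop :=
  (forall x, I01 x -> I01 (f x)) /\
  Cr 1 f /\
  f 1 = 0 /\
  (exists! c, is_critical f c) /\
  f (critical_point f) = 1.

Definition quadratic_tip (f : R -> R) : Prop :=
  let c := critical_point f in
  exists (x : nat -> R) (A : R),
    (forall n, I01 (x n) /\ x n <> c) /\
    is_lim_seq x c /\
    0 < A /\
    is_lim_seq (fun n => (f (x n) - f c) / (x n - c) ^ 2) (- A).

Definition U (r : nat) (f : R -> R) : Prop :=
  unimodal f /\ Cr r f /\ quadratic_tip f.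

Definition U2_Holder (alpha : R) (f : R -> R) : Prop :=
  unimodal f /\ quadratic_tip f /\
  exists df ddf K,
    (forall x, I01 x -> D_in f df I01 x) /\
    (forall x, I01 x -> D_in df ddf I01 x) /\
    (* [Rpower 0 alpha] is not 0, hence [x <> y] *)
    (forall x y, I01 x -> I01 y -> x <> y ->
       Rabs (ddf x - ddf y) <= K * Rpower (Rabs (x - y)) alpha).

(* f^k (c) *)
Definition crit_orbit (f : R -> R) (k : nat) : R :=
  Nat.iter k f (critical_point f).

Definition I0 (f : R -> R) (x : R) : Prop :=
  crit_orbit f 2 <= x <= crit_orbit f 4.

Definition I1 (f : R -> R) (x : R) : Prop :=
  crit_orbit f 3 <= x <= crit_orbit f 1.

Definition renormalizable (f : R -> R) : Prop :=
  unimodal f /\ quadratic_tip f /\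
  I0 f (critical_point f) /\
  (forall y, (exists x, I0 f x /\ f x = y) <-> I1 f y) /\
  (forall x, ~ (I0 f x /\ I1 f x)).

(* The affine map with h 0 = f^4 (c) and h 1 = f^2 (c), and its inverse. *)
Definition renorm_h (f : R -> R) (x : R) : R :=
  crit_orbit f 4 + x * (crit_orbit f 2 - crit_orbit f 4).

Definition renorm_h_inv (f : R -> R) (y : R) : R :=
  (y - crit_orbit f 4) / (crit_orbit f 2 - crit_orbit f 4).

Definition renorm (f : R -> R) : R -> R :=
  fun x => renorm_h_inv f (f (f (renorm_h f x))).

Definition infinitely_renormalizable (f : R -> R) : Prop :=
  forall n : nat, renormalizable (Nat.iter n renorm f).

Definition renorm_fixed (f : R -> R) : Prop :=
  renormalizable f /\ forall x, I01 x -> renorm f x = f x.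

Definition analytic_I01 (f : R -> R) : Prop :=
  forall x0, I01 x0 -> exists (a : nat -> R) (r : R), 0 < r /\
    forall x, I01 x -> Rabs (x - x0) < r -> is_pseries a (x - x0) (f x).

(* [fs] is the fixed point given by Davie's theorem: analytic and, for every
   alpha < 1 close enough to 1, the only renormalization fixed point in
   U^{2+alpha}.  This determines [fs] on [0,1]. *)
Definition analytic_fixed_point (fs : R -> R) : Prop :=
  analytic_I01 fs /\
  exists alpha0, 0 < alpha0 < 1 /\
    forall alpha, alpha0 < alpha < 1 ->
      (U2_Holder alpha fs /\ renorm_fixed fs) /\
      (forall g, U2_Holder alpha g -> renorm_fixed g ->
         forall x, I01 x -> g x = fs x).

Definition dist0 (f g : R -> R) : R :=
  real (Lub_Rbar (fun r => exists x, I01 x /\ r = Rabs (f x - g x))).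

(* Self-maps of [0,1] are at distance at most 1, so a lower bound d_n on
   [dist0] can only be asked for when d_n is small: a term d_n > 1 has to be
   replaced by its minimum with a constant. *)
Lemma dist0_le_1 (f g : R -> R) :
  (forall x, I01 x -> I01 (f x)) -> (forall x, I01 x -> I01 (g x)) ->
  dist0 f g <= 1.
Proof.
intros Hf Hg; unfold dist0.
destruct (Lub_Rbar_correct
  (fun r => exists x, I01 x /\ r = Rabs (f x - g x))) as [_ Hlub].
assert (H1 : Rbar_le (Lub_Rbar
  (fun r => exists x, I01 x /\ r = Rabs (f x - g x))) 1).
{ apply Hlub; intros r (x & Hx & ->); simpl.
  specialize (Hf x Hx); specialize (Hg x Hx); unfold I01 in *.
  apply Rabs_le; lra. }
destruct (Lub_Rbar _); simpl in *; lra.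
Qed.

(* Main.v *)
(* Write [c] for the critical point, [w = fs 0], [v = fs w] and [h x = v * (1 - x)].
   Then [I_0 = [0, v]], [I_1 = [w, 1]], [h c = c], and the fixed point equation
   reads [fs o fs o h = h o fs].  Precompose [fs] with a homeomorphism [theta] of
   [[0,1]] that preserves [I_0] and is the identity on [I_1]: the inner copy of
   [theta] is all that survives in the renormalization, so
   [R (fs o theta) = fs o (h^-1 o theta o h)].  Let [theta] be the identity plus,
   for each [n], a copy rescaled by [h^n] of a bump of height [e_n ~ d_n] in the
   gap [(v, w)].  Then [R^n] brings the [n]-th bump to the gap, where [fs] is not
   critical, and moves the map by at least [d_n].  At scale [v^n] around [c],
   [theta''] is of order [e_n v^-n] and [fs'] of order [v^n], hence
   [(fs o theta)''] extends continuously to [c] exactly because [e_n -> 0]. *)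
Require Import Defs.
From Stdlib Require Import Reals Lra Lia ClassicalEpsilon.
From Coquelicot Require Import Coquelicot.
Open Scope R_scope.

(** * Limits and derivatives relative to [[0,1]] *)

(** Limits carry their domain here. Passing between derivatives on the line and derivatives relative
    to [0,1] comes down to this comparison of germs. *)
Lemma limit1_in_local (f g : R -> R) (D E : R -> Prop) (l x0 r : R) :
  0 < r ->
  (forall x, E x -> Rabs (x - x0) < r -> D x /\ f x = g x) ->
  limit1_in f D l x0 -> limit1_in g E l x0.
Proof.
intros Hr Hloc Hf eps Heps.
destruct (Hf eps Heps) as (a & Ha & H).
exists (Rmin r a); split; [apply Rlt_gt, Rmin_glb_lt; lra|].
intros x [Ex Hx].
assert (Hx' : Rabs (x - x0) < Rmin r a) by exact Hx.
assert (H1 := Rmin_l r a); assert (H2 := Rmin_r r a).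
destruct (Hloc x Ex ltac:(lra)) as [Dx <-].
apply H; split; [exact Dx|].
change (Rabs (x - x0) < a); lra.
Qed.

Lemma D_in_local (f g df dg : R -> R) (D E : R -> Prop) (x0 r : R) :
  0 < r ->
  (forall x, E x -> Rabs (x - x0) < r -> D x /\ f x = g x) ->
  f x0 = g x0 -> df x0 = dg x0 ->
  D_in f df D x0 -> D_in g dg E x0.
Proof.
intros Hr Hloc Hf0 Hdf0; unfold D_in; rewrite Hdf0.
apply limit1_in_local with r; [exact Hr|].
intros x [Ex Hx] Hxr; destruct (Hloc x Ex Hxr) as [Dx Hfx].
split; [split; assumption|]; rewrite Hfx, Hf0; reflexivity.
Qed.

Lemma D_in_I01_ext (f g df : R -> R) (x : R) :
  (forall y, I01 y -> f y = g y) -> I01 x ->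
  D_in f df I01 x -> D_in g df I01 x.
Proof.
intros Hfg Hx; apply D_in_local with 1; auto with real.
Qed.

Lemma is_derive_D_in (f df : R -> R) (D : R -> Prop) (x : R) :
  is_derive f x (df x) -> D_in f df D x.
Proof.
intros H; apply D_in_local with f df no_cond 1; auto with real.
- intros; split; [exact I|reflexivity].
- apply derivable_pt_lim_D_in, is_derive_Reals, H.
Qed.

Lemma continuous_continue_in (f : R -> R) (D : R -> Prop) (x : R) :
  continuous f x -> continue_in f D x.
Proof.
intros H; apply continuity_pt_filterlim in H.
apply limit1_in_local with f (D_x no_cond x) 1; [lra| |exact H].
intros y [_ Hy] _; repeat split; exact Hy.
Qed.

Lemma D_in_is_derive (f df : R -> R) (x : R) :
  0 < x < 1 -> D_in f df I01 x -> is_derive f x (df x).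
Proof.
intros Hx H; apply is_derive_Reals, derivable_pt_lim_D_in.
apply D_in_local with f df I01 (Rmin x (1 - x)); auto.
- apply Rmin_glb_lt; lra.
- intros y _ Hy; assert (H1 := Rmin_l x (1 - x)); assert (H2 := Rmin_r x (1 - x)).
  apply Rabs_def2 in Hy; unfold I01; split; [lra|reflexivity].
Qed.

Lemma D_in_comp_I01 (f g df dg : R -> R) (x : R) :
  (forall y, I01 y -> I01 (f y)) ->
  D_in f df I01 x -> D_in g dg I01 (f x) ->
  D_in (fun y => g (f y)) (fun y => df y * dg (f y)) I01 x.
Proof.
intros Hf H1 H2; generalize (Dcomp I01 I01 df dg f g x H1 H2).
apply D_in_local with 1; auto with real.
intros y Hy _; split; [exact (conj Hy (Hf y Hy))|reflexivity].
Qed.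

Lemma continue_in_comp_I01 (f g : R -> R) (x : R) :
  (forall y, I01 y -> I01 (f y)) ->
  continue_in f I01 x -> continue_in g I01 (f x) ->
  continue_in (fun y => g (f y)) I01 x.
Proof.
intros Hf H1 H2 eps Heps.
destruct (H2 eps Heps) as (a & Ha & Hg).
destruct (H1 a Ha) as (b & Hb & Hfb).
exists b; split; [exact Hb|]; intros y [[Hy Hxy] Hd].
(* [continue_in] is a punctured limit, so points where [f] takes the value [f x] again are treated
   apart. *)
destruct (Req_dec (f y) (f x)) as [->|Hne].
- change (Rabs (g (f x) - g (f x)) < eps).
  rewrite Rminus_diag, Rabs_R0; exact Heps.
- apply Hg; repeat split; [apply Hf; exact Hy..|congruence|].
  apply Hfb; repeat split; try apply Hy; assumption.
Qed.

Lemma is_critical_derive (f df : R -> R) (x : R) :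
  0 < x < 1 -> D_in f df I01 x -> (is_critical f x <-> df x = 0).
Proof.
intros Hx H; split.
- intros [_ H0].
  apply (D_in_is_derive _ (fun _ => 0)) in H0; [|exact Hx].
  apply D_in_is_derive in H; [|exact Hx].
  rewrite <- (is_derive_unique _ _ _ H).
  exact (is_derive_unique _ _ _ H0).
- intros H0; split; [exact Hx|]; unfold D_in; rewrite <- H0; exact H.
Qed.

Lemma critical_point_unique (f : R -> R) (c : R) :
  is_critical f c -> (forall x, is_critical f x -> x = c) ->
  critical_point f = c.
Proof.
intros Hc Hu; apply Hu; unfold critical_point; apply epsilon_spec.
exists c; exact Hc.
Qed.

Lemma IVT_I01 (f : R -> R) (a b y : R) :
  (forall x, I01 x -> continue_in f I01 x) ->
  I01 a -> I01 b -> a <= b -> f a <= y <= f b ->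
  exists x, a <= x <= b /\ f x = y.
Proof.
intros Hf Ha Hb Hab Hy; unfold I01 in Ha, Hb.
(* The clamp onto [0,1] is 1-Lipschitz, so [f] composed with it is continuous on the whole line and
   the usual intermediate value theorem applies. *)
set (p x := Rmax 0 (Rmin 1 x)).
assert (Hp : forall x, I01 (p x)).
{ intros x; unfold p, I01; split; [apply Rmax_l|].
  apply Rmax_lub; [lra|apply Rmin_l]. }
assert (Hpid : forall x, 0 <= x <= 1 -> p x = x).
{ intros x Hx; unfold p; rewrite Rmin_right, Rmax_right; lra. }
assert (Hlip : forall x x', Rabs (p x - p x') <= Rabs (x - x')).
{ intros x x'; unfold p, Rmax, Rmin, Rabs.
  repeat (destruct Rle_dec || destruct Rcase_abs); lra. }
assert (Hc : continuity (fun x => f (p x))).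
{ intros x eps Heps; destruct (Hf (p x) (Hp x) eps Heps) as (d & Hd & H).
  exists d; split; [exact Hd|]; intros x' [_ Hx'].
  destruct (Req_dec (p x') (p x)) as [->|Hne].
  - change (Rabs (f (p x) - f (p x)) < eps).
    rewrite Rminus_diag, Rabs_R0; exact Heps.
  - apply H; repeat split; [apply Hp..|congruence|].
    apply Rle_lt_trans with (2 := Hx'); apply Hlip. }
destruct (IVT_gen _ a b y Hc) as (x & Hx & Hxy).
{ rewrite !Hpid by lra; rewrite Rmin_left, Rmax_right by lra; exact Hy. }
rewrite Rmin_left, Rmax_right in Hx by lra.
exists x; split; [exact Hx|]; rewrite <- Hxy, Hpid by lra; reflexivity.
Qed.

(** Taylor's formula in Peano form: the remainder has derivative [df y - ddf c * (y - c)], which is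
    o(y - c), and the mean value theorem passes this on. The limit in [quadratic_tip] thus depends
    only on the second derivative at [c]. *)
Lemma second_order_at_critical (f df ddf : R -> R) (c : R) (x : nat -> R) :
  (forall y, I01 y -> D_in f df I01 y) -> D_in df ddf I01 c ->
  0 < c < 1 -> df c = 0 ->
  (forall n, I01 (x n) /\ x n <> c) -> is_lim_seq x c ->
  is_lim_seq (fun n => (f (x n) - f c) / (x n - c) ^ 2) (ddf c / 2).
Proof.
intros Hf Hdf Hc Hdc Hx Hlim.
apply is_lim_seq_spec; intros [eps Heps]; simpl.
destruct (Hdf (eps / 2) ltac:(lra)) as (a & Ha & H).
apply is_lim_seq_spec in Hlim.
assert (Hr : 0 < Rmin a (Rmin c (1 - c))).
{ apply Rmin_glb_lt; [lra|apply Rmin_glb_lt; lra]. }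
destruct (Hlim (mkposreal _ Hr)) as (N & HN); simpl in HN.
exists N; intros n Hn; specialize (HN n Hn); destruct (Hx n) as [_ Hne].
set (z := x n) in *; clearbody z.
assert (Hm : Rabs (z - c) < a /\ Rabs (z - c) < c /\ Rabs (z - c) < 1 - c).
{ assert (h1 := Rmin_l a (Rmin c (1 - c))); assert (h2 := Rmin_r a (Rmin c (1 - c))).
  assert (h3 := Rmin_l c (1 - c)); assert (h4 := Rmin_r c (1 - c)); lra. }
assert (Hin : forall y, Rmin c z <= y <= Rmax c z ->
  0 < y < 1 /\ Rabs (y - c) <= Rabs (z - c)).
{ intros y Hy; destruct Hm as (_ & h1 & h2); revert Hy h1 h2.
  unfold Rmin, Rmax, Rabs.
  repeat (destruct Rle_dec || destruct Rcase_abs); lra. }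
assert (Hder : forall y, Rmin c z <= y <= Rmax c z ->
  is_derive (fun y => f y - ddf c / 2 * (y - c) ^ 2) y (df y - ddf c * (y - c))).
{ intros y Hy; destruct (Hin y Hy) as [Hy1 _].
  assert (D := D_in_is_derive f df y Hy1 (Hf y (conj (Rlt_le _ _ (proj1 Hy1)) (Rlt_le _ _ (proj2 Hy1))))).
  apply (is_derive_minus f (fun y => ddf c / 2 * (y - c) ^ 2) y (df y) (ddf c * (y - c)) D).
  auto_derive; [exact I|field]. }
destruct (MVT_gen (fun y => f y - ddf c / 2 * (y - c) ^ 2) c z
  (fun y => df y - ddf c * (y - c))) as (y & Hy & Heq).
- intros y Hy; apply Hder; lra.
- intros y Hy; apply continuity_pt_filterlim.
  apply (ex_derive_continuous (fun y => f y - ddf c / 2 * (y - c) ^ 2)).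
  eexists; apply Hder, Hy.
- destruct (Hin y Hy) as [Hy1 Hyz].
  assert (Hb : Rabs (df y - ddf c * (y - c)) <= eps / 2 * Rabs (y - c)).
  { destruct (Req_dec y c) as [->|Hyc].
    - rewrite Hdc, Rminus_diag, Rmult_0_r, Rminus_0_r, Rabs_R0; lra.
    - assert (Hq : Rabs ((df y - df c) / (y - c) - ddf c) < eps / 2).
      { apply H; split; [split; [unfold I01; lra|congruence]|].
        change (Rabs (y - c) < a); lra. }
      replace (df y - ddf c * (y - c))
        with (((df y - df c) / (y - c) - ddf c) * (y - c))
        by (rewrite Hdc; field; lra).
      rewrite Rabs_mult; apply Rmult_le_compat_r; [apply Rabs_pos|lra]. }
  assert (Hpos : 0 < Rabs (z - c)) by (apply Rabs_pos_lt; lra).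
  assert (Hsq : (z - c) ^ 2 <> 0) by (apply pow_nonzero; lra).
  change (Rabs ((f z - f c) / (z - c) ^ 2 - ddf c / 2) < eps).
  replace ((f z - f c) / (z - c) ^ 2 - ddf c / 2)
    with ((df y - ddf c * (y - c)) / (z - c)).
  2:{ apply Rmult_eq_reg_r with ((z - c) ^ 2); [|exact Hsq].
      transitivity (f z - f c - ddf c / 2 * (z - c) ^ 2); [|field; lra].
      rewrite Rminus_diag in Heq.
      transitivity ((df y - ddf c * (y - c)) * (z - c)); [field; lra|].
      rewrite <- Heq; ring. }
  unfold Rdiv; rewrite Rabs_mult, Rabs_inv.
  apply Rmult_lt_reg_r with (Rabs (z - c)); [exact Hpos|].
  rewrite Rmult_assoc, Rinv_l, Rmult_1_r by lra.
  assert (h : eps / 2 * Rabs (y - c) <= eps / 2 * Rabs (z - c))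
    by (apply Rmult_le_compat_l; lra).
  assert (h' : 0 < eps * Rabs (z - c)) by (apply Rmult_lt_0_compat; assumption).
  lra.
Qed.

(** [real] sends an infinite supremum to 0, so finiteness has to be shown; it follows from the bound
    1 for self-maps of [0,1]. *)
Lemma dist0_ge (f g : R -> R) (x : R) :
  (forall y, I01 y -> I01 (f y)) -> (forall y, I01 y -> I01 (g y)) ->
  I01 x -> Rabs (f x - g x) <= dist0 f g.
Proof.
intros Hf Hg Hx; unfold dist0.
set (E := fun r => exists y, I01 y /\ r = Rabs (f y - g y)).
destruct (Lub_Rbar_correct E) as [Hub Hlub].
assert (H1 : Rbar_le (Rabs (f x - g x)) (Lub_Rbar E)).
{ apply Hub; exists x; split; [exact Hx|reflexivity]. }
assert (H2 : Rbar_le (Lub_Rbar E) 1).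
{ apply Hlub; intros r (y & Hy & ->); simpl.
  specialize (Hf y Hy); specialize (Hg y Hy); unfold I01 in *.
  apply Rabs_le; lra. }
destruct (Lub_Rbar E); simpl in *; [exact H1|contradiction..].
Qed.

(** * Bump functions *)

(** The error of the linear approximation is at most h^2, even across the kink, so delta = eps
    works. *)
Lemma is_derive_Rmax0_sqr (t : R) :
  is_derive (fun s => Rmax 0 s ^ 2) t (2 * Rmax 0 t).
Proof.
apply is_derive_Reals; intros eps Heps.
exists (mkposreal eps Heps); intros h Hh Hd; simpl in Hd.
apply Rle_lt_trans with (2 := Hd).
apply Rmult_le_reg_r with (Rabs h); [apply Rabs_pos_lt, Hh|].
rewrite <- Rabs_mult, <- Rabs_mult.
replace (((Rmax 0 (t + h) ^ 2 - Rmax 0 t ^ 2) / h - 2 * Rmax 0 t) * h)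
  with (Rmax 0 (t + h) ^ 2 - Rmax 0 t ^ 2 - 2 * Rmax 0 t * h) by (field; exact Hh).
rewrite (Rabs_pos_eq (h * h)) by nra.
apply Rabs_le; unfold Rmax; repeat destruct Rle_dec; nra.
Qed.

(** The bump is the cube of the positive part of 1 - y^2; the third power makes the second
    derivative continuous at the ends of the support. The bound 30 = 6 + 24 is crude and serves both
    derivatives. *)
Lemma unit_bump : exists b b1 b2 : R -> R,
  (forall y, is_derive b y (b1 y)) /\ (forall y, is_derive b1 y (b2 y)) /\
  (forall y, continuous b2 y) /\ b 0 = 1 /\
  (forall y, 0 <= b y <= 1 /\ Rabs (b1 y) <= 30 /\ Rabs (b2 y) <= 30) /\
  (forall y, 1 <= Rabs y -> b y = 0 /\ b1 y = 0 /\ b2 y = 0).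
Proof.
set (p t := Rmax 0 t); set (q y := 1 - y ^ 2).
assert (Hp : forall y, is_derive (fun y => p (q y) ^ 2) y (- 4 * y * p (q y))).
{ intros y.
  replace (- 4 * y * p (q y)) with (- 2 * y * (2 * p (q y))) by ring.
  apply (is_derive_comp (fun s => p s ^ 2) q y (2 * p (q y)) (- 2 * y)).
  - apply is_derive_Rmax0_sqr.
  - unfold q; auto_derive; [exact I|ring]. }
(* [q * (Rmax 0 q)^2] is the cube of [Rmax 0 q]. *)
exists (fun y => q y * p (q y) ^ 2), (fun y => - 6 * y * p (q y) ^ 2),
  (fun y => - 6 * p (q y) ^ 2 + 24 * y ^ 2 * p (q y)).
assert (Hq : forall y, q y * p (q y) = p (q y) ^ 2).
{ intros y; unfold p, Rmax; destruct Rle_dec; ring. }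
assert (Hcases : forall y, (p (q y) = 0 /\ 1 <= Rabs y) \/
  (0 <= p (q y) <= 1 /\ -1 <= y <= 1 /\ p (q y) = q y)).
{ intros y; unfold p, q; destruct (Rle_dec 1 (Rabs y)) as [H|H].
  - left; split; [|exact H]; apply Rmax_left.
    rewrite <- (pow2_abs y); nra.
  - right; assert (H' : Rabs y <= 1) by lra; apply Rabs_le_between in H'.
    rewrite Rmax_right by nra; nra. }
split; [|split; [|split; [|split; [|split]]]].
- intros y.
  replace (- 6 * y * p (q y) ^ 2)
    with (- 2 * y * p (q y) ^ 2 + q y * (- 4 * y * p (q y))).
  2:{ replace (q y * (- 4 * y * p (q y))) with (- 4 * y * (q y * p (q y))) by ring.
      rewrite Hq; ring. }
  apply (is_derive_mult q (fun y => p (q y) ^ 2) y (- 2 * y)); [|apply Hp|apply Rmult_comm].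
  unfold q; auto_derive; [exact I|ring].
- intros y.
  replace (- 6 * p (q y) ^ 2 + 24 * y ^ 2 * p (q y))
    with (- 6 * p (q y) ^ 2 + - 6 * y * (- 4 * y * p (q y))) by ring.
  apply (is_derive_mult (fun y => - 6 * y) (fun y => p (q y) ^ 2) y (- 6));
    [|apply Hp|apply Rmult_comm].
  auto_derive; [exact I|ring].
- intros y; apply continuity_pt_filterlim.
  assert (Hcp : continuity (fun y => p (q y))).
  { intros z; apply continuity_pt_filterlim.
    apply (continuous_comp q p).
    - apply (ex_derive_continuous q); unfold q; auto_derive; exact I.
    - apply (continuous_comp (fun s => s) (fun s => Rmax 0 s)); [apply continuous_id|].
      apply continuity_pt_filterlim; intros eps Heps; exists eps; split; [exact Heps|].
      intros s [_ Hs]; apply Rle_lt_trans with (2 := Hs); simpl; unfold R_dist.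
      unfold Rmax, Rabs; repeat (destruct Rle_dec || destruct Rcase_abs); lra. }
  assert (Hcy : continuity (fun y => 24 * y ^ 2)) by (apply derivable_continuous; reg).
  apply (continuity_pt_plus (fun y => - 6 * p (q y) ^ 2) (fun y => 24 * y ^ 2 * p (q y))).
  + apply (continuity_pt_scal (fun y => p (q y) ^ 2) (- 6)).
    apply (continuity_pt_mult (fun y => p (q y)) (fun y => p (q y) * 1)); [apply Hcp|].
    apply (continuity_pt_mult (fun y => p (q y)) (fun y => 1)); [apply Hcp|].
    apply continuity_pt_const; intros ? ?; reflexivity.
  + apply (continuity_pt_mult (fun y => 24 * y ^ 2) (fun y => p (q y))); auto.
- unfold p, q; rewrite Rmax_right; lra.
- intros y; destruct (Hcases y) as [[-> _]|(H1 & H2 & H3)].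
  + rewrite !pow_i, !Rmult_0_r, Rplus_0_r, Rabs_R0 by lia; lra.
  + rewrite H3 in *; set (t := q y) in *; clearbody t.
    assert (0 <= t ^ 2 <= 1) by nra; assert (0 <= y ^ 2 <= 1) by nra.
    repeat split; try (apply Rabs_le); nra.
- intros y Hy; destruct (Hcases y) as [[-> _]|(_ & H2 & ->)].
  + repeat split; ring.
  + assert (Hq0 : q y = 0).
    { assert (1 <= Rabs y ^ 2) by nra; rewrite pow2_abs in H; unfold q; nra. }
    rewrite Hq0; repeat split; ring.
Qed.

Lemma bump (x0 r : R) : 0 < r -> exists (b b1 b2 : R -> R) (K : R),
  (forall y, is_derive b y (b1 y)) /\ (forall y, is_derive b1 y (b2 y)) /\
  (forall y, continuous b2 y) /\ b x0 = 1 /\ 0 < K /\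
  (forall y, 0 <= b y <= 1 /\ Rabs (b1 y) <= K /\ Rabs (b2 y) <= K) /\
  (forall y, ~ (x0 - r < y < x0 + r) -> b y = 0 /\ b1 y = 0 /\ b2 y = 0).
Proof.
intros Hr; destruct unit_bump as (b & b1 & b2 & H1 & H2 & H3 & H4 & H5 & H6).
set (s y := (y - x0) / r).
assert (Hs : forall y, is_derive s y (/ r)).
{ intros y; unfold s; auto_derive; [exact I|field; lra]. }
assert (Hr' : 0 < / r) by (apply Rinv_0_lt_compat, Hr).
(* Each derivative costs a factor 1/r; the sum of the two bounds serves for both. *)
exists (fun y => b (s y)), (fun y => / r * b1 (s y)), (fun y => / r * (/ r * b2 (s y))),
  (30 * / r + 30 * (/ r * / r)).
split; [|split; [|split; [|split; [|split; [|split]]]]].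
- intros y; apply (is_derive_comp b s y (b1 (s y)) (/ r)); auto.
- intros y.
  apply (is_derive_scal (fun y => b1 (s y)) y (/ r)).
  apply (is_derive_comp b1 s y (b2 (s y)) (/ r)); auto.
- intros y; apply (continuous_scal_r (/ r) (fun y => / r * b2 (s y))).
  apply (continuous_scal_r (/ r) (fun y => b2 (s y))).
  apply (continuous_comp s b2); [|apply H3].
  apply (ex_derive_continuous s); eexists; apply Hs.
- unfold s; replace ((x0 - x0) / r) with 0 by (field; lra); exact H4.
- nra.
- intros y; destruct (H5 (s y)) as (h1 & h2 & h3); rewrite !Rabs_mult.
  rewrite (Rabs_pos_eq (/ r)) by lra; split; [exact h1|].
  assert (0 < / r * / r) by nra; split; nra.
- intros y Hy; destruct (H6 (s y)) as (-> & -> & ->).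
  + unfold s, Rdiv; rewrite Rabs_mult, (Rabs_pos_eq (/ r)) by lra.
    apply Rmult_le_reg_r with r; [exact Hr|].
    rewrite Rmult_assoc, Rinv_l, Rmult_1_r, Rmult_1_l by lra.
    unfold Rabs; destruct Rcase_abs; apply Rnot_lt_le; intros H; apply Hy; lra.
  + repeat split; ring.
Qed.

(** * The self-similar perturbation of the identity *)

(* With [c = v * (1 - c)] this is the [n]-th iterate of [x |-> 1 - x / v], the
   inverse of the affine rescaling [h x = v * (1 - x)], whose fixed point is [c]. *)
Definition zoom (c v : R) (n : nat) (x : R) : R := c + (- / v) ^ n * (x - c).

(** If no zoom brings [x] into the interval, the index is arbitrary; this is harmless, since a
    profile supported there vanishes at every [zoom n x]. *)
Definition level (c v lo hi x : R) : nat :=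
  epsilon (inhabits 0%nat) (fun n => lo < zoom c v n x < hi).

(* For [k] supported in [[lo, hi]] at most one term of the series
   [sum_n e_n (-v)^n (-1/v)^(n j) k (zoom n x)] is not zero, and this is that
   term; [j] counts the derivatives taken of the series with [j = 0]. *)
Definition bump_sum (c v lo hi : R) (e : nat -> R) (j : nat) (k : R -> R) (x : R) : R :=
  let n := level c v lo hi x in
  e n * (- v) ^ n * ((- / v) ^ n) ^ j * k (zoom c v n x).

Definition theta (c v lo hi : R) (b : R -> R) (e : nat -> R) (x : R) : R :=
  x + bump_sum c v lo hi e 0 b x.

Section Perturbation.

Variables c v lo hi : R.
Hypothesis Hcv : c = v * (1 - c).
Hypothesis Hc : 0 < c < v.
Hypothesis Hlo : v < lo.
Hypothesis Hlohi : lo < hi < 1.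

Notation zoom := (zoom c v).
Notation bump_sum := (bump_sum c v lo hi).

(** * Orbits of the zoom *)

Lemma zoom_O (x : R) : zoom 0 x = x.
Proof. unfold zoom; simpl; ring. Qed.

Lemma zoom_S (n : nat) (x : R) : zoom (S n) x = 1 - zoom n x / v.
Proof.
unfold zoom; simpl.
assert (H : c = 1 - c / v) by (rewrite Hcv at 2; field; lra).
rewrite H at 1; field; lra.
Qed.

Lemma zoom_rescale (n : nat) (x : R) : zoom (S n) (v * (1 - x)) = zoom n x.
Proof.
unfold zoom; simpl; rewrite Hcv at 2; field; lra.
Qed.

Lemma pow_inv_cancel (n : nat) : (- v) ^ n * (- / v) ^ n = 1.
Proof.
rewrite <- Rpow_mult_distr; replace (- v * - / v) with 1 by (field; lra).
apply pow1.
Qed.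

Lemma unzoom (n : nat) (x : R) : x - c = (- v) ^ n * (zoom n x - c).
Proof.
unfold zoom; transitivity ((- v) ^ n * (- / v) ^ n * (x - c)); [|ring].
rewrite pow_inv_cancel; ring.
Qed.

Lemma zoom_center (n : nat) : zoom n c = c.
Proof. unfold zoom; ring. Qed.

(** x |-> 1 - x / v sends points above [v] below 0 and points below 0 above 1, so an orbit that has
    left [0,v] upwards alternates between the two sides for ever. *)
Lemma zoom_escaped (n k : nat) (x : R) :
  v < zoom n x -> zoom (n + S k) x < 0 \/ 1 < zoom (n + S k) x.
Proof.
intros Hn; assert (Hv : 0 < / v) by (apply Rinv_0_lt_compat; lra).
assert (Hvv : v * / v = 1) by (field; lra).
induction k as [|k IH].
- rewrite Nat.add_1_r, zoom_S; unfold Rdiv; left; nra.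
- rewrite Nat.add_succ_r, zoom_S; unfold Rdiv.
  destruct IH; [right|left]; nra.
Qed.

(** Pulling back by z |-> v * (1 - z) keeps the interval from -v * (lo - v) to [lo] invariant,
    because v < 1. The window for [zoom n x] extends past 1 by [lo - v] so that it is an open
    neighbourhood of (v,1], as differentiation requires. *)
Lemma zoom_not_yet (n m : nat) (x : R) :
  v < zoom n x < 1 + (lo - v) -> (m < n)%nat -> zoom m x < lo.
Proof.
intros Hn Hm.
assert (Hstep : forall k, zoom k x = v * (1 - zoom (S k) x)).
{ intros k; rewrite zoom_S; field; lra. }
assert (H : forall k, (k < n)%nat -> - v * (lo - v) < zoom (n - S k) x < lo).
{ induction k as [|k IH]; intros Hk; rewrite Hstep.
  - replace (S (n - 1)) with n by lia; nra.
  - replace (S (n - S (S k))) with (n - S k)%nat by lia.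
    specialize (IH ltac:(lia)); nra. }
replace m with (n - S (n - S m))%nat by lia; apply H; lia.
Qed.

(** The zoom maps [0,v] onto [0,1], so an orbit that avoids (v,1] stays in [0,v]; but its distance
    to [c] grows by the factor 1/v > 1 at each step. *)
Lemma zoom_exit (x : R) : I01 x -> x <> c -> exists n, v < zoom n x <= 1.
Proof.
intros Hx Hxc; apply NNPP; intros Hno.
assert (Hv : 0 < / v) by (apply Rinv_0_lt_compat; lra).
assert (Hin : forall n, 0 <= zoom n x <= v).
{ assert (Hle : forall n, 0 <= zoom n x <= 1 -> 0 <= zoom n x <= v).
  { intros n Hn; split; [apply Hn|].
    apply Rnot_lt_le; intros H; apply Hno; exists n; lra. }
  induction n as [|n IH]; apply Hle.
  - rewrite zoom_O; exact Hx.
  - rewrite zoom_S; assert (v * / v = 1) by (field; lra); unfold Rdiv; nra. }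
destruct (Pow_x_infinity (- / v)) with (b := 2 / Rabs (x - c)) as (N & HN).
{ rewrite Rabs_Ropp, Rabs_pos_eq by lra; rewrite <- Rinv_1.
  apply Rinv_lt_contravar; lra. }
specialize (HN N (Nat.le_refl N)); specialize (Hin N).
assert (Hpos : 0 < Rabs (x - c)) by (apply Rabs_pos_lt; lra).
assert (H : Rabs (zoom N x - c) >= 2).
{ unfold zoom; replace (c + (- / v) ^ N * (x - c) - c) with ((- / v) ^ N * (x - c)) by ring.
  rewrite Rabs_mult; replace 2 with (2 / Rabs (x - c) * Rabs (x - c)) by (field; lra).
  apply Rmult_ge_compat_r; lra. }
revert H; unfold Rabs; destruct Rcase_abs; lra.
Qed.

(** Earlier zooms of [x] lie below [lo] and later ones outside [0,1], so [level] can only be [n]. If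
    no level exists, both sides vanish. *)
Lemma bump_sum_at (e : nat -> R) (j n : nat) (k : R -> R) (x : R) :
  (forall y, ~ (lo < y < hi) -> k y = 0) ->
  v < zoom n x < 1 + (lo - v) ->
  bump_sum e j k x = e n * (- v) ^ n * ((- / v) ^ n) ^ j * k (zoom n x).
Proof.
intros Hk Hn; unfold bump_sum.
destruct (excluded_middle_informative (lo < zoom (level c v lo hi x) x < hi)) as [H|H].
- replace (level c v lo hi x) with n; [reflexivity|].
  set (m := level c v lo hi x) in *.
  destruct (Nat.lt_trichotomy m n) as [Hmn|[Hmn|Hmn]]; [|auto|].
  + assert (Hlt := zoom_not_yet n m x Hn Hmn); lra.
  + destruct (zoom_escaped n (m - S n) x); [lra|..];
      replace (n + S (m - S n))%nat with m in * by lia; lra.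
- rewrite (Hk _ H), (Hk (zoom n x)); [ring|].
  intros H'; apply H.
  apply (epsilon_spec (inhabits 0%nat) (fun n => lo < zoom n x < hi)).
  exists n; exact H'.
Qed.

Lemma bump_sum_center (e : nat -> R) (j : nat) (k : R -> R) :
  (forall y, ~ (lo < y < hi) -> k y = 0) -> bump_sum e j k c = 0.
Proof.
intros Hk; unfold bump_sum; rewrite zoom_center, Hk; [ring|lra].
Qed.

Lemma zoom_derive (n : nat) (x : R) : is_derive (zoom n) x ((- / v) ^ n).
Proof. unfold zoom; auto_derive; [exact I|ring]. Qed.

Lemma zoom_locally (n : nat) (x : R) :
  v < zoom n x <= 1 -> locally x (fun y => v < zoom n y < 1 + (lo - v)).
Proof.
intros Hn.
assert (Hz : continuous (zoom n) x)
  by (apply (ex_derive_continuous (zoom n)); eexists; apply zoom_derive).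
apply filter_and.
- apply (Hz (fun z => v < z)), (open_gt v); lra.
- apply (Hz (fun z => z < 1 + (lo - v))), (open_lt (1 + (lo - v))); lra.
Qed.

(** Away from [c] the sum is locally a single term, and the chain rule contributes the factor
    (-1/v)^n that [S j] counts. *)
Lemma bump_sum_derive (e : nat -> R) (j : nat) (k dk : R -> R) (x : R) :
  (forall y, ~ (lo < y < hi) -> k y = 0) ->
  (forall y, ~ (lo < y < hi) -> dk y = 0) ->
  (forall y, is_derive k y (dk y)) ->
  I01 x -> x <> c ->
  is_derive (bump_sum e j k) x (bump_sum e (S j) dk x).
Proof.
intros Hk Hdk Hder Hx Hxc; destruct (zoom_exit x Hx Hxc) as (n & Hn).
rewrite (bump_sum_at e (S j) n dk x) by (auto; lra).
apply (is_derive_ext_loc (fun y => e n * (- v) ^ n * ((- / v) ^ n) ^ j * k (zoom n y))).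
{ apply (filter_imp _ _ (fun y Hy => eq_sym (bump_sum_at e j n k y Hk Hy))).
  apply zoom_locally, Hn. }
replace (e n * (- v) ^ n * ((- / v) ^ n) ^ S j * dk (zoom n x))
  with (e n * (- v) ^ n * ((- / v) ^ n) ^ j * ((- / v) ^ n * dk (zoom n x)))
  by (simpl; ring).
apply is_derive_scal.
apply (is_derive_comp k (zoom n)); [apply Hder|apply zoom_derive].
Qed.

Lemma bump_sum_continuous (e : nat -> R) (j : nat) (k : R -> R) (x : R) :
  (forall y, ~ (lo < y < hi) -> k y = 0) ->
  (forall y, continuous k y) ->
  I01 x -> x <> c -> continuous (bump_sum e j k) x.
Proof.
intros Hk Hcont Hx Hxc; destruct (zoom_exit x Hx Hxc) as (n & Hn).
apply (continuous_ext_loc _ (fun y => e n * (- v) ^ n * ((- / v) ^ n) ^ j * k (zoom n y))).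
{ apply (filter_imp _ _ (fun y Hy => eq_sym (bump_sum_at e j n k y Hk Hy))).
  apply zoom_locally, Hn. }
apply (continuous_scal_r (e n * (- v) ^ n * ((- / v) ^ n) ^ j) (fun y => k (zoom n y))).
apply (continuous_comp (zoom n) k); [|apply Hcont].
apply (ex_derive_continuous (zoom n)); eexists; apply zoom_derive.
Qed.

Lemma zoom_exit_small (e : nat -> R) (eps : R) :
  is_lim_seq e 0 -> 0 < eps ->
  exists d, 0 < d /\ forall x, I01 x -> x <> c -> Rabs (x - c) < d ->
    exists n, v < zoom n x <= 1 /\ Rabs (e n) < eps.
Proof.
intros He Heps; apply is_lim_seq_spec in He.
destruct (He (mkposreal eps Heps)) as (N & HN); simpl in HN.
assert (HvN : forall n, 0 < v ^ n) by (intros n; apply pow_lt; lra).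
(* A point that exits at a level n < N lies at distance v^n * (zoom n x - c) > v^N * (v - c) from
   [c]. *)
exists (v ^ N * (v - c)); split; [apply Rmult_lt_0_compat; [apply HvN|lra]|].
intros x Hx Hxc Hd; destruct (zoom_exit x Hx Hxc) as (n & Hn).
exists n; split; [exact Hn|].
rewrite <- (Rminus_0_r (e n)); apply HN.
destruct (Nat.le_gt_cases N n) as [|Hlt]; [assumption|exfalso].
rewrite (unzoom n x), Rabs_mult, <- RPow_abs, Rabs_Ropp in Hd.
rewrite (Rabs_pos_eq v), (Rabs_pos_eq (zoom n x - c)) in Hd by lra.
assert (H : v ^ N <= v ^ n).
{ replace N with (n + (N - n))%nat by lia; rewrite pow_add.
  rewrite <- (Rmult_1_r (v ^ n)) at 2.
  apply Rmult_le_compat_l; [apply Rlt_le, HvN|].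
  rewrite <- (pow1 (N - n)); apply pow_incr; lra. }
assert (HN' := HvN N); assert (Hn' := HvN n); nra.
Qed.

(** * The map [theta] and its derivatives *)

Section Bump.

Variables (b b1 b2 : R -> R) (K E : R).
Hypothesis Hb1 : forall y, is_derive b y (b1 y).
Hypothesis Hb2 : forall y, is_derive b1 y (b2 y).
Hypothesis Hb2c : forall y, continuous b2 y.
Hypothesis Hbound : forall y, 0 <= b y <= 1 /\ Rabs (b1 y) <= K /\ Rabs (b2 y) <= K.
Hypothesis Hsupp : forall y, ~ (lo < y < hi) -> b y = 0 /\ b1 y = 0 /\ b2 y = 0.
Hypothesis HK : 0 < K.
(** In this order the bounds keep [theta1] positive, keep [theta] from sending another point to [c],
    and keep displaced points below 1. *)
Hypothesis HE : E * K <= / 2 /\ E <= (v - c) / 2 /\ hi + E <= 1.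

Definition amplitudes (e : nat -> R) : Prop :=
  (forall n, 0 <= e n <= E) /\ is_lim_seq e 0.

Notation theta := (theta c v lo hi b).

(** In the coordinate [zoom n] the map reads z |-> z + e n * b z: the factor (-v)^n of the sum
    undoes the zoom. *)
Lemma theta_at (e : nat -> R) (n : nat) (x : R) :
  v < zoom n x <= 1 ->
  theta e x = c + (- v) ^ n * (zoom n x + e n * b (zoom n x) - c).
Proof.
intros Hn; unfold theta; rewrite (bump_sum_at e 0 n).
- assert (H := unzoom n x); simpl.
  transitivity (c + (x - c) + (- v) ^ n * (e n * b (zoom n x))); [ring|].
  rewrite H; ring.
- intros y Hy; apply Hsupp, Hy.
- lra.
Qed.

Lemma theta_center (e : nat -> R) : theta e c = c.
Proof.
unfold theta; rewrite bump_sum_center; [ring|]; intros y Hy; apply Hsupp, Hy.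
Qed.

Lemma theta_O (e : nat -> R) (x : R) : v < x <= 1 -> theta e x = x + e O * b x.
Proof.
intros Hx; rewrite (theta_at e 0); rewrite zoom_O; [simpl; ring|exact Hx].
Qed.

(** Since [zoom (S n)] after the rescaling is [zoom n], conjugation by the rescaling drops the first
    amplitude. This is the effect of renormalization on [theta]. *)
Lemma theta_rescale (e : nat -> R) (x : R) :
  I01 x -> theta e (v * (1 - x)) = v * (1 - theta (fun n => e (S n)) x).
Proof.
intros Hx; destruct (Req_dec x c) as [->|Hxc].
- rewrite <- Hcv, !theta_center; exact Hcv.
- destruct (zoom_exit x Hx Hxc) as (n & Hn).
  rewrite (theta_at (fun n => e (S n)) n x Hn), (theta_at e (S n)); rewrite zoom_rescale.
  + simpl; rewrite Hcv at 1; ring.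
  + exact Hn.
Qed.

Lemma theta_0 (e : nat -> R) : theta e 0 = 0.
Proof.
replace 0 with (v * (1 - 1)) at 1 by ring.
rewrite theta_rescale by (unfold I01; lra).
rewrite theta_O by lra; rewrite (proj1 (Hsupp 1 ltac:(lra))); ring.
Qed.

Lemma theta_interior (e : nat -> R) (x : R) :
  (forall n, 0 <= e n <= E) -> 0 < x < 1 -> 0 < theta e x < 1.
Proof.
intros He Hx; destruct (Req_dec x c) as [->|Hxc]; [rewrite theta_center; exact Hx|].
destruct (zoom_exit x (conj (Rlt_le _ _ (proj1 Hx)) (Rlt_le _ _ (proj2 Hx))) Hxc)
  as (n & Hn).
destruct (excluded_middle_informative (lo < zoom n x < hi)) as [H|H].
- rewrite (theta_at e n x Hn); set (z := zoom n x) in *.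
  assert (Hz : 0 < z + e n * b z < 1).
  { specialize (He n); destruct (Hbound z) as [Hbz _]; split; [nra|].
    assert (e n * b z <= E * 1) by (apply Rmult_le_compat; lra); lra. }
  (* The point is now the n-th image under z |-> v * (1 - z), which maps (0,1) into itself, of a
     point of (0,1). *)
  clear -Hz Hcv Hc Hlo Hlohi; set (y := z + e n * b z) in *; clearbody y; clear z.
  induction n as [|n IH]; [simpl; lra|].
  replace (c + (- v) ^ S n * (y - c)) with (v * (1 - (c + (- v) ^ n * (y - c)))).
  + nra.
  + simpl; rewrite Hcv at 3; ring.
- rewrite (theta_at e n x Hn), (proj1 (Hsupp _ H)), Rmult_0_r, Rplus_0_r, <- unzoom.
  lra.
Qed.

Lemma theta_I01 (e : nat -> R) (x : R) :
  (forall n, 0 <= e n <= E) -> I01 x -> I01 (theta e x).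
Proof.
intros He Hx.
destruct (Req_dec x 0) as [->|H0]; [rewrite theta_0; exact Hx|].
destruct (Req_dec x 1) as [->|H1].
- rewrite theta_O, (proj1 (Hsupp 1 ltac:(lra))) by lra; unfold I01; lra.
- unfold I01 in *; assert (H := theta_interior e x He ltac:(lra)); lra.
Qed.

(** [0,v] is the image of [0,1] under the rescaling, which reduces the claim to [theta_I01] for the
    shifted amplitudes. *)
Lemma theta_I0 (e : nat -> R) (x : R) :
  (forall n, 0 <= e n <= E) -> 0 <= x <= v -> 0 <= theta e x <= v.
Proof.
intros He Hx; assert (Hv : 0 < / v) by (apply Rinv_0_lt_compat; lra).
assert (Hvv : v * / v = 1) by (field; lra).
replace x with (v * (1 - (1 - x / v))) by (field; lra).
assert (Hx' : I01 (1 - x / v)) by (unfold I01, Rdiv; nra).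
rewrite theta_rescale by exact Hx'.
apply (theta_I01 (fun n => e (S n))) in Hx'; [unfold I01 in Hx'; nra|].
intros n; apply He.
Qed.

(** The displacement is at most e n * v^n, while x is at distance at least v^n * (v - c) from
    [c]. *)
Lemma theta_near (e : nat -> R) (n : nat) (x : R) :
  0 <= e n -> v < zoom n x <= 1 -> Rabs (theta e x - x) * (v - c) <= e n * Rabs (x - c).
Proof.
intros He Hn.
replace (theta e x - x) with ((- v) ^ n * (e n * b (zoom n x))).
2:{ rewrite (theta_at e n x Hn).
    transitivity (c + (- v) ^ n * (zoom n x - c) + (- v) ^ n * (e n * b (zoom n x)) - x);
      [rewrite <- unzoom|]; ring. }
rewrite (unzoom n x), !Rabs_mult, (Rabs_pos_eq (e n)), (Rabs_pos_eq (zoom n x - c)) by lra.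
destruct (Hbound (zoom n x)) as [Hbz _]; rewrite (Rabs_pos_eq (b _)) by lra.
assert (Hp := Rabs_pos ((- v) ^ n)); set (a := Rabs ((- v) ^ n)) in *.
assert (Hae : 0 <= a * e n) by (apply Rmult_le_pos; lra).
assert (b (zoom n x) * (v - c) <= 1 * (zoom n x - c)) by (apply Rmult_le_compat; lra).
replace (a * (e n * b (zoom n x)) * (v - c)) with (a * e n * (b (zoom n x) * (v - c))) by ring.
replace (e n * (a * (zoom n x - c))) with (a * e n * (1 * (zoom n x - c))) by ring.
apply Rmult_le_compat_l; assumption.
Qed.

Lemma theta_eq_center (e : nat -> R) (x : R) :
  (forall n, 0 <= e n <= E) -> I01 x -> theta e x = c -> x = c.
Proof.
intros He Hx Hth; destruct (Req_dec x c) as [|Hxc]; [assumption|exfalso].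
destruct (zoom_exit x Hx Hxc) as (n & Hn).
assert (H := theta_near e n x (proj1 (He n)) Hn); specialize (He n).
rewrite Hth, (Rabs_minus_sym c x) in H.
assert (0 < Rabs (x - c)) by (apply Rabs_pos_lt; lra); nra.
Qed.

Definition theta1 (e : nat -> R) (x : R) : R := 1 + bump_sum e 1 b1 x.
(** It serves as the derivative of [theta1] away from [c] only; at [c] it takes the default value
    0. *)
Definition theta2 (e : nat -> R) (x : R) : R := bump_sum e 2 b2 x.

Lemma theta1_at (e : nat -> R) (n : nat) (x : R) :
  v < zoom n x <= 1 -> theta1 e x = 1 + e n * b1 (zoom n x).
Proof.
intros Hn; unfold theta1; rewrite (bump_sum_at e 1 n); [|intros; apply Hsupp; auto|lra].
rewrite pow_1, Rmult_assoc, Rmult_assoc, <- (Rmult_assoc ((- v) ^ n)), pow_inv_cancel.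
ring.
Qed.

Lemma theta1_center (e : nat -> R) : theta1 e c = 1.
Proof.
unfold theta1; rewrite bump_sum_center; [ring|]; intros y Hy; apply Hsupp, Hy.
Qed.

Lemma theta1_pos (e : nat -> R) (x : R) :
  (forall n, 0 <= e n <= E) -> I01 x -> 0 < theta1 e x.
Proof.
intros He Hx; destruct (Req_dec x c) as [->|Hxc]; [rewrite theta1_center; lra|].
destruct (zoom_exit x Hx Hxc) as (n & Hn); rewrite (theta1_at e n x Hn).
destruct (Hbound (zoom n x)) as (_ & H & _); apply Rabs_le_between in H.
specialize (He n); nra.
Qed.

Lemma theta_derive (e : nat -> R) (x : R) :
  I01 x -> x <> c -> is_derive (theta e) x (theta1 e x).
Proof.
intros Hx Hxc; apply (is_derive_plus (fun y => y) (bump_sum e 0 b) x 1 (bump_sum e 1 b1 x)).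
- apply (is_derive_id x).
- apply bump_sum_derive; auto; intros; apply Hsupp; auto.
Qed.

Lemma theta1_derive (e : nat -> R) (x : R) :
  I01 x -> x <> c -> is_derive (theta1 e) x (theta2 e x).
Proof.
intros Hx Hxc; rewrite <- (Rplus_0_l (theta2 e x)).
apply (is_derive_plus (fun y => 1) (bump_sum e 1 b1) x 0 (theta2 e x)).
- apply (is_derive_const 1 x).
- apply bump_sum_derive; auto; intros; apply Hsupp; auto.
Qed.

Lemma theta_D_in (e : nat -> R) (x : R) :
  amplitudes e -> I01 x -> D_in (theta e) (theta1 e) I01 x.
Proof.
intros [He Hlim] Hx; destruct (Req_dec x c) as [->|Hxc].
2:{ apply is_derive_D_in, theta_derive; assumption. }
intros eps Heps.
(* By [theta_near] the difference quotient at [c] differs from 1 by at most e n / (v - c), with n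
   the exit level. *)
destruct (zoom_exit_small e (eps * (v - c)) Hlim) as (d & Hd & H).
{ apply Rmult_lt_0_compat; lra. }
exists d; split; [exact Hd|]; intros y [[Hy Hyc] Hyd].
destruct (H y Hy ltac:(congruence) Hyd) as (n & Hn & Hen).
assert (Hnear := theta_near e n y (proj1 (He n)) Hn).
rewrite (Rabs_pos_eq (e n)) in Hen by apply He.
change (Rabs ((theta e y - theta e c) / (y - c) - theta1 e c) < eps).
rewrite theta_center, theta1_center.
assert (Hyc' : y - c <> 0) by (intros h; apply Hyc; lra).
assert (Hpos : 0 < Rabs (y - c)) by (apply Rabs_pos_lt; exact Hyc').
replace ((theta e y - c) / (y - c) - 1) with ((theta e y - y) / (y - c)) by (field; exact Hyc').
unfold Rdiv; rewrite Rabs_mult, Rabs_inv.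
apply Rmult_lt_reg_r with (Rabs (y - c) * (v - c)); [apply Rmult_lt_0_compat; lra|].
replace (Rabs (theta e y - y) * / Rabs (y - c) * (Rabs (y - c) * (v - c)))
  with (Rabs (theta e y - y) * (v - c)) by (field; lra).
apply Rle_lt_trans with (1 := Hnear); nra.
Qed.

Lemma theta1_continue_in (e : nat -> R) (x : R) :
  amplitudes e -> I01 x -> continue_in (theta1 e) I01 x.
Proof.
intros [He Hlim] Hx; destruct (Req_dec x c) as [->|Hxc].
2:{ apply cont_deriv with (theta2 e), is_derive_D_in, theta1_derive; assumption. }
intros eps Heps.
destruct (zoom_exit_small e (eps / K) Hlim) as (d & Hd & H).
{ apply Rdiv_lt_0_compat; lra. }
exists d; split; [exact Hd|]; intros y [[Hy Hyc] Hyd].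
destruct (H y Hy ltac:(congruence) Hyd) as (n & Hn & Hen).
change (Rabs (theta1 e y - theta1 e c) < eps).
rewrite theta1_center, (theta1_at e n y Hn).
replace (1 + e n * b1 (zoom n y) - 1) with (e n * b1 (zoom n y)) by ring.
rewrite Rabs_mult; destruct (Hbound (zoom n y)) as (_ & Hbz & _).
apply Rle_lt_trans with (Rabs (e n) * K).
- apply Rmult_le_compat_l; [apply Rabs_pos|exact Hbz].
- replace eps with (eps / K * K) by (field; lra); apply Rmult_lt_compat_r; assumption.
Qed.

(* [theta2] may be unbounded near [c]; only this much is true. *)
Lemma theta2_limit (e : nat -> R) :
  amplitudes e ->
  limit1_in (fun x => theta2 e x * (x - c)) (D_x I01 c) 0 c.
Proof.
intros [He Hlim] eps Heps.
destruct (zoom_exit_small e (eps / K) Hlim) as (d & Hd & H).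
{ apply Rdiv_lt_0_compat; lra. }
exists d; split; [exact Hd|]; intros y [[Hy Hyc] Hyd].
destruct (H y Hy ltac:(congruence) Hyd) as (n & Hn & Hen).
change (Rabs (theta2 e y * (y - c) - 0) < eps).
unfold theta2; rewrite (bump_sum_at e 2 n); [|intros; apply Hsupp; auto|lra].
rewrite (unzoom n y).
(* The two factors (-1/v)^n are absorbed by (-v)^n from the amplitude and (-v)^n from y - c. *)
replace (e n * (- v) ^ n * ((- / v) ^ n) ^ 2 * b2 (zoom n y) *
  ((- v) ^ n * (zoom n y - c)) - 0)
  with (((- v) ^ n * (- / v) ^ n) ^ 2 * (e n * (b2 (zoom n y) * (zoom n y - c)))) by ring.
rewrite pow_inv_cancel, pow1, Rmult_1_l, !Rabs_mult.
destruct (Hbound (zoom n y)) as (_ & _ & Hbz).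
rewrite (Rabs_pos_eq (zoom n y - c)) by lra.
apply Rle_lt_trans with (Rabs (e n) * (K * 1)).
- apply Rmult_le_compat_l; [apply Rabs_pos|].
  apply Rmult_le_compat; [apply Rabs_pos|lra..].
- replace eps with (eps / K * (K * 1)) by (field; lra).
  apply Rmult_lt_compat_r; [lra|assumption].
Qed.

End Bump.
End Perturbation.

(** * Perturbations of the fixed point *)

(** The main point is c = v * (1 - c). At the preimage 1 - c/v of [c] under the rescaling, the fixed
    point equation gives the value 1; an interior point with this maximal value is critical, hence
    equal to [c]. *)
Lemma fixed_point_geometry (fs : R -> R) (c v w : R) :
  renorm_fixed fs ->
  c = critical_point fs -> w = fs 0 -> v = fs w ->
  is_critical fs c /\ (forall x, is_critical fs x -> x = c) /\
  fs c = 1 /\ fs 1 = 0 /\ 0 < c < v /\ v < w < 1 /\ c = v * (1 - c) /\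
  (forall x, I01 x -> (fs (fs (v * (1 - x))) - v) / (0 - v) = fs x) /\
  (forall x, 0 <= x <= v -> w <= fs x <= 1).
Proof.
intros [(Hu & _ & Hc0 & Himg & Hdis) Hfix] Hc Hw Hv.
destruct Hu as (Hself & (df & Hdf & _) & Hf1 & (c' & Hc' & Huniq) & Hfc).
rewrite <- Hc in Hfc.
assert (Hcc : critical_point fs = c').
{ apply critical_point_unique; [exact Hc'|]; intros x Hx; symmetry; apply Huniq, Hx. }
rewrite <- Hc in Hcc; subst c'.
assert (Hcrit : forall x, is_critical fs x -> x = c)
  by (intros x Hx; symmetry; apply Huniq, Hx).
(* The critical orbit starts with c, 1, 0, w, v. *)
unfold I0, I1, renorm, renorm_h_inv, renorm_h, crit_orbit in *; simpl in *.
rewrite <- Hc in *; rewrite Hfc, Hf1, <- Hw, <- Hv in *.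
assert (Hc01 : 0 < c < 1) by apply Hc'.
assert (Hw1 : 0 <= w <= 1) by (rewrite Hw; apply (Hself 0); unfold I01; lra).
assert (Hv1 : 0 <= v <= 1).
{ rewrite Hv; apply (Hself w), Hw1. }
assert (Hvw : v < w).
{ apply Rnot_le_lt; intros H; apply (Hdis w); lra. }
assert (Hmax : forall x, 0 < x < 1 -> fs x = 1 -> x = c).
{ intros x Hx Hfx; apply Hcrit.
  apply (is_critical_derive fs df); [exact Hx|apply Hdf; unfold I01; lra|].
  assert (D := Hdf x (conj (Rlt_le _ _ (proj1 Hx)) (Rlt_le _ _ (proj2 Hx)))).
  apply D_in_is_derive in D; [|exact Hx]; apply is_derive_Reals in D.
  set (pr := exist _ (df x) D : derivable_pt fs x).
  change (df x) with (derive_pt fs x pr).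
  apply deriv_maximum with 0 1; [lra|lra|]; intros y Hy0 Hy1; rewrite Hfx.
  apply Hself; unfold I01; lra. }
assert (Hwlt : w < 1).
{ destruct (Rle_lt_or_eq_dec _ _ (proj2 Hw1)) as [|He]; [assumption|].
  rewrite He in Hv; lra. }
assert (Hpre : 0 <= 1 - c / v < 1).
{ assert (0 < / v) by (apply Rinv_0_lt_compat; lra).
  assert (v * / v = 1) by (field; lra); unfold Rdiv; nra. }
assert (Hval : fs (1 - c / v) = 1).
{ rewrite <- Hfix by (unfold I01; lra).
  replace (v + (1 - c / v) * (0 - v)) with c by (field; lra).
  rewrite Hfc, Hf1; field; lra. }
assert (Hpre0 : 0 < 1 - c / v).
{ destruct (Rle_lt_or_eq_dec _ _ (proj1 Hpre)) as [|He]; [assumption|].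
  rewrite <- He in Hval; lra. }
assert (Hfixc := Hmax _ (conj Hpre0 (proj2 Hpre)) Hval).
assert (Hcv : c = v * (1 - c)) by (rewrite <- Hfixc at 2; field; lra).
repeat split; try assumption; try lra; try apply Hc'.
- nra.
- intros x Hx; replace (v * (1 - x)) with (v + x * (0 - v)) by ring.
  apply Hfix, Hx.
- apply (Himg (fs x)); exists x; split; [assumption|reflexivity].
- apply (Himg (fs x)); exists x; split; [assumption|reflexivity].
Qed.

(** * The maps fs o theta and their renormalizations *)

Section Perturbed.

Variables (fs df ddf : R -> R) (c v w lo hi : R).
Hypothesis Hself : forall x, I01 x -> I01 (fs x).
Hypothesis Hdf : forall x, I01 x -> D_in fs df I01 x.
Hypothesis Hddf : forall x, I01 x -> D_in df ddf I01 x.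
Hypothesis Hddfc : forall x, I01 x -> continue_in ddf I01 x.
Hypothesis Hcrit : is_critical fs c.
Hypothesis Hcritu : forall x, is_critical fs x -> x = c.
Hypothesis Hquad : quadratic_tip fs.
Hypothesis Hfc : fs c = 1.
Hypothesis Hf1 : fs 1 = 0.
Hypothesis Hf0 : fs 0 = w.
Hypothesis Hfw : fs w = v.
Hypothesis Hfix : forall x, I01 x -> (fs (fs (v * (1 - x))) - v) / (0 - v) = fs x.
Hypothesis Himg : forall x, 0 <= x <= v -> w <= fs x <= 1.

Hypothesis Hcv : c = v * (1 - c).
Hypothesis Hc : 0 < c < v.
Hypothesis Hlo : v < lo.
Hypothesis Hlohi : lo < hi < 1.
Hypothesis Hhiw : hi < w < 1.

Variables (b b1 b2 : R -> R) (K E : R).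
Hypothesis Hb1 : forall y, is_derive b y (b1 y).
Hypothesis Hb2 : forall y, is_derive b1 y (b2 y).
Hypothesis Hb2c : forall y, continuous b2 y.
Hypothesis Hbound : forall y, 0 <= b y <= 1 /\ Rabs (b1 y) <= K /\ Rabs (b2 y) <= K.
Hypothesis Hsupp : forall y, ~ (lo < y < hi) -> b y = 0 /\ b1 y = 0 /\ b2 y = 0.
Hypothesis HK : 0 < K.
Hypothesis HE : E * K <= / 2 /\ E <= (v - c) / 2 /\ hi + E <= 1.

Notation th e := (theta c v lo hi b e).
Notation th1 e := (theta1 c v lo hi b1 e).
Notation th2 e := (theta2 c v lo hi b2 e).

(** Agreement on [0,1] only is the form that [renorm] preserves. *)
Definition perturbed (e : nat -> R) (f : R -> R) : Prop :=
  forall x, I01 x -> f x = fs (th e x).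

Definition perturbed1 (e : nat -> R) (x : R) : R := th1 e x * df (th e x).

Definition perturbed2 (e : nat -> R) (x : R) : R :=
  th2 e x * df (th e x) + th1 e x * (th1 e x * ddf (th e x)).

Variables (e : nat -> R) (f : R -> R).
Hypothesis He : amplitudes E e.
Hypothesis Hf : perturbed e f.

Lemma th_I01 (x : R) : I01 x -> I01 (th e x).
Proof. intros Hx; destruct He; eapply theta_I01; eauto. Qed.

Lemma th_D_in (x : R) : I01 x -> D_in (th e) (th1 e) I01 x.
Proof. intros Hx; eapply theta_D_in; eauto. Qed.

Lemma th_center : th e c = c.
Proof. eapply theta_center; eauto. Qed.

Lemma th1_center : th1 e c = 1.
Proof. eapply theta1_center; eauto. Qed.

Lemma critical_derivative : df c = 0.
Proof.
apply (is_critical_derive fs df c); [apply Hcrit| |exact Hcrit].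
apply Hdf; unfold I01; lra.
Qed.

Lemma perturbed_I01 (x : R) : I01 x -> I01 (f x).
Proof. intros Hx; rewrite Hf by exact Hx; apply Hself, th_I01, Hx. Qed.

Lemma perturbed_D_in (x : R) : I01 x -> D_in f (perturbed1 e) I01 x.
Proof.
intros Hx; apply D_in_I01_ext with (fun y => fs (th e y)); [|exact Hx|].
- intros y Hy; symmetry; apply Hf, Hy.
- apply D_in_comp_I01; [apply th_I01|apply th_D_in, Hx|apply Hdf, th_I01, Hx].
Qed.

Lemma df_th_D_in (x : R) :
  I01 x -> D_in (fun y => df (th e y)) (fun y => th1 e y * ddf (th e y)) I01 x.
Proof.
intros Hx.
apply D_in_comp_I01; [apply th_I01|apply th_D_in, Hx|apply Hddf, th_I01, Hx].
Qed.

Lemma df_th_center : df (th e c) = 0.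
Proof. rewrite th_center; apply critical_derivative. Qed.

Lemma th1_continue_in (x : R) : I01 x -> continue_in (th1 e) I01 x.
Proof. intros Hx; eapply theta1_continue_in; eauto. Qed.

Lemma perturbed1_D_in (x : R) : I01 x -> D_in (perturbed1 e) (perturbed2 e) I01 x.
Proof.
intros Hx; destruct (Req_dec x c) as [->|Hxc].
- (* [theta1] need not be differentiable at [c], but its factor [df o theta]
     vanishes there. *)
  unfold D_in, perturbed2; rewrite df_th_center, Rmult_0_r, Rplus_0_l.
  apply limit1_ext with (fun y => th1 e y * ((df (th e y) - df (th e c)) / (y - c))).
  + intros y [_ Hy]; unfold perturbed1; rewrite df_th_center.
    field; intros h; apply Hy; lra.
  + apply limit_mul; [apply th1_continue_in, Hx|apply df_th_D_in, Hx].
- apply Dmult; [|apply df_th_D_in, Hx].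
  apply is_derive_D_in; eapply theta1_derive; eauto.
Qed.

Lemma perturbed2_continue_in (x : R) : I01 x -> continue_in (perturbed2 e) I01 x.
Proof.
intros Hx; apply limit_plus.
- destruct (Req_dec x c) as [->|Hxc].
  + rewrite df_th_center.
    (* Near [c] the product is split as th2 * (y - c), which tends to 0, times the difference
       quotient of df o th, which converges. *)
    replace (th2 e c * 0) with (0 * (th1 e c * ddf (th e c))) by ring.
    apply limit1_ext with
      (fun y => th2 e y * (y - c) * ((df (th e y) - df (th e c)) / (y - c))).
    * intros y [_ Hy]; rewrite df_th_center; field; intros h; apply Hy; lra.
    * apply limit_mul; [|apply df_th_D_in, Hx].
      eapply theta2_limit; eauto.
  + apply limit_mul.
    * apply continuous_continue_in; eapply bump_sum_continuous; eauto.
      intros; apply Hsupp; assumption.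
    * apply (cont_deriv _ _ _ _ (df_th_D_in x Hx)).
- apply limit_mul; [apply th1_continue_in, Hx|].
  apply limit_mul; [apply th1_continue_in, Hx|].
  apply (continue_in_comp_I01 (th e) ddf); [apply th_I01| |apply Hddfc, th_I01, Hx].
  apply (cont_deriv _ _ _ _ (th_D_in x Hx)).
Qed.

Lemma perturbed_Cr2 : Cr 2 f.
Proof.
exists (perturbed1 e); split; [apply perturbed_D_in|].
exists (perturbed2 e); split; [exact perturbed1_D_in|exact perturbed2_continue_in].
Qed.

(** As [theta1] is positive, f' vanishes only where theta x = c, that is, at [c]. *)
Lemma perturbed_critical (x : R) : is_critical f x <-> x = c.
Proof.
split.
- intros Hx; assert (Hx01 : 0 < x < 1) by apply Hx.
  assert (HxI : I01 x) by (unfold I01; lra).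
  apply (is_critical_derive f (perturbed1 e) x Hx01 (perturbed_D_in x HxI)) in Hx.
  destruct He as [He' _].
  assert (Hpos : 0 < th1 e x) by (eapply theta1_pos; eauto).
  assert (Hth : 0 < th e x < 1) by (eapply theta_interior; eauto).
  eapply (theta_eq_center c v lo hi); eauto.
  apply Hcritu, (is_critical_derive fs df); [exact Hth|apply Hdf, th_I01, HxI|].
  apply Rmult_integral in Hx; destruct Hx; [lra|assumption].
- intros ->; apply (is_critical_derive f (perturbed1 e)); [lra| |].
  + apply perturbed_D_in; unfold I01; lra.
  + unfold perturbed1; rewrite df_th_center; ring.
Qed.

Lemma perturbed_critical_point : critical_point f = c.
Proof. apply critical_point_unique; intros; apply perturbed_critical; auto. Qed.

(** [theta] fixes [c], 0 and every point of [w,1], so the critical orbit of [fs] is kept up to its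
    fourth iterate. *)
Lemma perturbed_values : f c = 1 /\ f 1 = 0 /\ f 0 = w /\ f w = v.
Proof.
assert (H1 : forall x, w <= x <= 1 -> th e x = x).
{ intros x Hx; assert (Hb : b x = 0) by (apply Hsupp; lra).
  transitivity (x + e O * b x); [eapply theta_O; eauto; lra|rewrite Hb; ring]. }
assert (H0 : th e 0 = 0) by (eapply theta_0; eauto).
rewrite !Hf by (unfold I01; lra).
rewrite th_center, (H1 1), H0, (H1 w) by lra; auto.
Qed.

Lemma perturbed_unimodal : unimodal f.
Proof.
destruct perturbed_values as (Vc & V1 & _).
split; [|split; [|split; [|split]]].
- apply perturbed_I01.
- exists (perturbed1 e); split; [apply perturbed_D_in|].
  intros x Hx; apply (cont_deriv _ _ _ _ (perturbed1_D_in x Hx)).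
- exact V1.
- exists c; split; [apply perturbed_critical; reflexivity|].
  intros x Hx; symmetry; apply perturbed_critical, Hx.
- rewrite perturbed_critical_point; exact Vc.
Qed.

Lemma perturbed_quadratic_tip : quadratic_tip f.
Proof.
destruct perturbed_values as (Vc & _).
assert (Hcfs : critical_point fs = c) by (apply critical_point_unique; assumption).
unfold quadratic_tip in *; rewrite perturbed_critical_point; rewrite Hcfs in Hquad.
destruct Hquad as (x & A & Hx & Hlim & HA & HlimA).
exists x, A; split; [exact Hx|split; [exact Hlim|split; [exact HA|]]].
assert (HcI : I01 c) by (unfold I01; lra).
assert (Hfs := second_order_at_critical fs df ddf c x Hdf (Hddf c HcI) ltac:(lra)
  critical_derivative Hx Hlim).
assert (Hfl := second_order_at_critical f (perturbed1 e) (perturbed2 e) c x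
  perturbed_D_in (perturbed1_D_in c HcI) ltac:(lra)
  ltac:(unfold perturbed1; rewrite df_th_center; ring) Hx Hlim).
(* The sequence and the constant of [fs] are reused: [theta] fixes [c] with slope 1, so both maps
   have the same second derivative there. *)
assert (HAd : Finite (- A) = Finite (ddf c / 2)).
{ rewrite <- (is_lim_seq_unique _ _ HlimA), <- (is_lim_seq_unique _ _ Hfs); reflexivity. }
rewrite HAd.
replace (ddf c) with (perturbed2 e c); [exact Hfl|].
unfold perturbed2; rewrite df_th_center, th1_center, th_center; ring.
Qed.

Lemma perturbed_renormalizable : renormalizable f.
Proof.
destruct perturbed_values as (Vc & V1 & V0 & Vw).
split; [apply perturbed_unimodal|split; [apply perturbed_quadratic_tip|]].
unfold I0, I1, crit_orbit; simpl; rewrite perturbed_critical_point.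
rewrite Vc, V1, V0, Vw; split; [lra|split; [|intros x; lra]].
intros y; split.
- intros (x & Hx & <-); rewrite Hf by (unfold I01; lra); apply Himg.
  destruct He; eapply theta_I0; eauto.
(* The subinterval [0,c] already covers [w,1], since f 0 = w and f c = 1. *)
- intros Hy; destruct (IVT_I01 f 0 c y) as (x & Hx & Hxy).
  + intros x Hx; apply (cont_deriv _ _ _ _ (perturbed_D_in x Hx)).
  + unfold I01; lra.
  + unfold I01; lra.
  + lra.
  + rewrite V0, Vc; exact Hy.
  + exists x; split; [lra|exact Hxy].
Qed.

(** The outer [theta] acts on [w,1], where it is the identity. The inner one commutes past the
    rescaling up to a shift of the amplitudes, and the fixed point equation of [fs] does the
    rest. *)
Lemma perturbed_renorm : perturbed (fun n => e (S n)) (renorm f).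
Proof.
destruct perturbed_values as (Vc & V1 & V0 & Vw); intros x Hx.
unfold renorm, renorm_h_inv, renorm_h, crit_orbit; simpl.
rewrite perturbed_critical_point, Vc, V1, V0, Vw.
replace (v + x * (0 - v)) with (v * (1 - x)) by ring.
destruct He as [He' _].
assert (Hh : 0 <= v * (1 - x) <= v) by (unfold I01 in Hx; nra).
rewrite (Hf (v * (1 - x))) by (unfold I01; lra).
assert (Hin : 0 <= th e (v * (1 - x)) <= v) by (eapply theta_I0; eauto).
assert (Hout := Himg _ Hin).
assert (Hres : th e (v * (1 - x)) = v * (1 - th (fun n => e (S n)) x))
  by (eapply theta_rescale; eauto).
rewrite Hf by (unfold I01; lra).
set (y := fs (th e (v * (1 - x)))) in *.
assert (Hy : th e y = y).
{ assert (Hb : b y = 0) by (apply Hsupp; lra).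
  transitivity (y + e O * b y); [eapply theta_O; eauto; lra|rewrite Hb; ring]. }
rewrite Hy; unfold y; rewrite Hres; apply Hfix.
eapply theta_I01; eauto.
Qed.

End Perturbed.

(** * Choice of the bump and the amplitudes *)

Lemma Holder_continue_in (g : R -> R) (D : R -> Prop) (K alpha x : R) :
  0 < alpha ->
  (forall x y, D x -> D y -> x <> y ->
     Rabs (g x - g y) <= K * Rpower (Rabs (x - y)) alpha) ->
  D x -> continue_in g D x.
Proof.
(* [K] may be zero or negative, so it is replaced by a constant that can be divided by. *)
intros Ha HK Hx eps Heps; set (K' := Rmax K 1).
assert (HK' : K <= K' /\ 1 <= K') by (split; [apply Rmax_l|apply Rmax_r]).
assert (Hq : 0 < eps / K') by (apply Rdiv_lt_0_compat; lra).
exists (Rpower (eps / K') (/ alpha)); split; [apply exp_pos|].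
intros y [[Hy Hxy] Hd]; change (Rabs (g y - g x) < eps).
change (Rabs (y - x) < Rpower (eps / K') (/ alpha)) in Hd.
apply Rle_lt_trans with (1 := HK y x Hy Hx (not_eq_sym Hxy)).
assert (Hp : 0 < Rabs (y - x)) by (apply Rabs_pos_lt; lra).
assert (H := Rlt_Rpower_l _ _ alpha Ha (conj Hp Hd)).
rewrite Rpower_mult, Rinv_l, Rpower_1 in H by lra.
assert (H0 : 0 < Rpower (Rabs (y - x)) alpha) by apply exp_pos.
replace eps with (K' * (eps / K')) by (field; lra).
apply Rle_lt_trans with (K' * Rpower (Rabs (y - x)) alpha); [|nra].
apply Rmult_le_compat_r; lra.
Qed.

(** It turns a displacement of the argument by [e n] into a displacement of the value by at least a
    fixed multiple of [e n]. *)
Lemma derive_lower_bound (f : R -> R) (x l : R) :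
  is_derive f x l -> l <> 0 ->
  exists t0, 0 < t0 /\ forall t, 0 <= t < t0 -> Rabs l / 2 * t <= Rabs (f (x + t) - f x).
Proof.
intros H Hl; apply is_derive_Reals in H.
assert (Hp : 0 < Rabs l) by (apply Rabs_pos_lt, Hl).
destruct (H (Rabs l / 2)) as ([t0 Ht0] & Ht); [lra|simpl in Ht].
exists t0; split; [exact Ht0|]; intros t Htt.
destruct (Req_dec t 0) as [->|Hne]; [rewrite Rmult_0_r; apply Rabs_pos|].
specialize (Ht t Hne ltac:(rewrite Rabs_pos_eq; lra)).
assert (Hq : Rabs l / 2 <= Rabs ((f (x + t) - f x) / t)).
{ assert (H1 := Rabs_triang_inv l (l - (f (x + t) - f x) / t)).
  replace (l - (l - (f (x + t) - f x) / t)) with ((f (x + t) - f x) / t) in H1 by ring.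
  rewrite (Rabs_minus_sym l) in H1; lra. }
unfold Rdiv at 2 in Hq; rewrite Rabs_mult, Rabs_inv, (Rabs_pos_eq t) in Hq by lra.
apply (Rmult_le_compat_r t) in Hq; [|lra].
rewrite Rmult_assoc, Rinv_l, Rmult_1_r in Hq by lra; exact Hq.
Qed.

Theorem theorem1p2 :
  forall fs : R -> R, analytic_fixed_point fs ->
  exists eps : R, 0 < eps /\
  forall d : nat -> R,
    (forall n, 0 < d n) -> is_lim_seq d 0 ->
    exists f : R -> R,
      U 2 f /\ infinitely_renormalizable f /\
      forall n : nat, dist0 (Nat.iter n renorm f) fs >= Rmin (d n) eps.
Proof.
intros fs (_ & alpha0 & Ha0 & Hfs).
destruct (Hfs ((alpha0 + 1) / 2) ltac:(lra)) as [[HU Hren] _]; clear Hfs.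
destruct HU as (Huni & Hquad & df & ddf & KH & Hdf & Hddf & HHol).
assert (Hddfc : forall x, I01 x -> continue_in ddf I01 x).
{ intros x Hx.
  apply Holder_continue_in with KH ((alpha0 + 1) / 2); [lra|exact HHol|exact Hx]. }
assert (Hself : forall x, I01 x -> I01 (fs x)) by apply Huni.
destruct (fixed_point_geometry fs _ _ _ Hren eq_refl eq_refl eq_refl)
  as (Hcrit & Hcritu & Hfc & Hf1 & Hc & Hvw & Hcv & Hfix & Himg).
set (c := critical_point fs) in *; set (v := fs (fs 0)) in *.
remember (fs 0) as w eqn:Hw; assert (Hf0 : fs 0 = w) by auto.
assert (Hfw : fs w = v) by reflexivity.
clearbody c v; clear Hw Huni Hren HHol.
(* The bump sits in the middle half of the gap (v,w). *)
set (x0 := (v + w) / 2); set (r := (w - v) / 4).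
destruct (bump x0 r ltac:(unfold r; lra))
  as (b & b1 & b2 & K & Hb1 & Hb2 & Hb2c & Hbx0 & HK & Hbound & Hsupp).
set (lo := x0 - r) in *; set (hi := x0 + r) in *.
assert (Hlo : v < lo) by (unfold lo, x0, r; lra).
assert (Hlohi : lo < hi < 1) by (unfold lo, hi, x0, r; lra).
assert (Hhiw : hi < w < 1) by (unfold hi, x0, r; lra).
assert (Hx0 : v < x0 < 1) by (unfold x0; lra).
assert (Hdx0 : df x0 <> 0).
{ intros H; assert (x0 = c); [|lra].
  apply Hcritu, (is_critical_derive fs df); [lra|apply Hdf; unfold I01; lra|exact H]. }
assert (Hm : 0 < Rabs (df x0)) by (apply Rabs_pos_lt, Hdx0).
destruct (derive_lower_bound fs x0 (df x0)) as (t0 & Ht0 & Hlow); [|exact Hdx0|].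
{ apply D_in_is_derive; [lra|apply Hdf; unfold I01; lra]. }
assert (HE : exists E, 0 < E /\ E < t0 /\
  (E * K <= / 2 /\ E <= (v - c) / 2 /\ hi + E <= 1)).
(* Besides the three bounds for [theta], E < t0 puts all amplitudes in the range of
   [derive_lower_bound]. *)
{ exists (Rmin (Rmin (/ 2 * / K) ((v - c) / 2)) (Rmin (1 - hi) (t0 / 2))).
  assert (HiK : 0 < / K) by (apply Rinv_0_lt_compat, HK).
  assert (h1 := Rmin_l (Rmin (/ 2 * / K) ((v - c) / 2)) (Rmin (1 - hi) (t0 / 2))).
  assert (h2 := Rmin_r (Rmin (/ 2 * / K) ((v - c) / 2)) (Rmin (1 - hi) (t0 / 2))).
  assert (h3 := Rmin_l (/ 2 * / K) ((v - c) / 2)).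
  assert (h4 := Rmin_r (/ 2 * / K) ((v - c) / 2)).
  assert (h5 := Rmin_l (1 - hi) (t0 / 2)).
  assert (h6 := Rmin_r (1 - hi) (t0 / 2)).
  split; [repeat apply Rmin_glb_lt; lra|].
  set (E := Rmin (Rmin _ _) _) in *; clearbody E.
  split; [lra|split; [|split; lra]].
  replace (/ 2) with (/ 2 * / K * K) by (field; lra).
  apply Rmult_le_compat_r; lra. }
destruct HE as (E & HE0 & HEt & HE).
(* The threshold is fixed before [d] is introduced. *)
exists (Rabs (df x0) / 2 * E); split; [apply Rmult_lt_0_compat; lra|].
intros d Hd Hdlim.
set (m := Rabs (df x0) / 2) in *; assert (Hm' : 0 < m) by (unfold m; lra).
(* This makes m * e n the required lower bound, while keeping e n <= E and e n -> 0. *)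
set (e n := / m * Rmin (d n) (m * E)).
assert (Him : 0 < / m) by (apply Rinv_0_lt_compat, Hm').
assert (He : amplitudes E e).
{ split.
  - intros n; unfold e; split.
    + apply Rmult_le_pos; [lra|]; apply Rmin_glb; [apply Rlt_le, Hd|nra].
    + replace E with (/ m * (m * E)) at 2 by (field; lra).
      apply Rmult_le_compat_l; [lra|apply Rmin_r].
  - apply is_lim_seq_le_le with (fun _ => 0) (fun n => / m * d n).
    + intros n; unfold e; split.
      * apply Rmult_le_pos; [lra|]; apply Rmin_glb; [apply Rlt_le, Hd|nra].
      * apply Rmult_le_compat_l; [lra|apply Rmin_l].
    + apply is_lim_seq_const.
    + replace (Finite 0) with (Rbar_mult (/ m) 0) by (simpl; f_equal; ring).
      apply is_lim_seq_scal_l, Hdlim. }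
assert (Hshift : forall n, amplitudes E (fun k => e (n + k)%nat)).
{ intros n; split; [intros k; apply He|].
  apply is_lim_seq_ext with (fun k => e (k + n)%nat); [intros k; f_equal; lia|].
  apply (is_lim_seq_incr_n e n), He. }
set (f x := fs (theta c v lo hi b e x)).
(* After n renormalizations the amplitude [e n] belongs to the bump in the gap. *)
assert (Hpert : forall n,
  perturbed fs c v lo hi b (fun k => e (n + k)%nat) (Nat.iter n renorm f)).
{ induction n as [|n IH]; [intros x Hx; reflexivity|].
  intros x Hx; replace (fun k => e (S n + k)%nat) with (fun k => e (n + S k)%nat)
    by (apply FunctionalExtensionality.functional_extensionality; intros k; f_equal; lia).
  revert x Hx.
  eapply (perturbed_renorm fs df c v w lo hi) with
    (b := b) (b1 := b1) (b2 := b2) (K := K) (E := E)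
    (e := fun k => e (n + k)%nat); eauto. }
exists f; clearbody f; split; [|split].
- specialize (Hpert O); simpl in Hpert.
  split; [|split].
  + eapply (perturbed_unimodal fs df ddf c v w lo hi) with
      (b := b) (b1 := b1) (b2 := b2) (K := K) (E := E) (e := e); eauto.
  + eapply (perturbed_Cr2 fs df ddf c v lo hi) with
      (b := b) (b1 := b1) (b2 := b2) (K := K) (E := E) (e := e); eauto.
  + eapply (perturbed_quadratic_tip fs df ddf c v w lo hi) with
      (b := b) (b1 := b1) (b2 := b2) (K := K) (E := E) (e := e); eauto.
- intros n; eapply (perturbed_renormalizable fs df ddf c v w lo hi) with
    (b := b) (b1 := b1) (b2 := b2) (K := K) (E := E)
    (e := fun k => e (n + k)%nat); eauto.
- intros n; apply Rle_ge.
  (* The distance is tested at the top of the bump, which [theta] moves by exactly [e n]. *)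
  apply Rle_trans with (Rabs (Nat.iter n renorm f x0 - fs x0)).
  2:{ apply dist0_ge; [|exact Hself|unfold I01; lra].
      intros y Hy; eapply (perturbed_I01 fs c v lo hi) with
        (b := b) (b1 := b1) (b2 := b2) (K := K) (E := E)
        (e := fun k => e (n + k)%nat); eauto. }
  rewrite (Hpert n) by (unfold I01; lra).
  assert (Hth : theta c v lo hi b (fun k => e (n + k)%nat) x0 = x0 + e n).
  { transitivity (x0 + e (n + 0)%nat * b x0); [eapply (theta_O c v lo hi); eauto; lra|].
    rewrite Hbx0, Nat.add_0_r; ring. }
  rewrite Hth.
  replace (Rmin (d n) (m * E)) with (m * e n) by (unfold e; field; lra).
  apply Hlow; destruct He as [He _]; specialize (He n); lra.
Qed.
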